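(* Let $M,\rho,l,k,T_0,\omega>0$ and $\alpha>0$, and put $\Omega_L=\sqrt{k/M}$, $\Omega_T=\frac{\pi}{2l}\sqrt{T_0/\rho}$, $\omega_L=\omega/\Omega_L$, $\omega_T=\omega/\Omega_T$. Consider the main-harmonic balance equations for the coefficients $A,B$ of the steady transverse oscillation $w(t)=A\cos\frac{\omega t}{2}+B\sin\frac{\omega t}{2}$: $$\frac{\pi^2}{4l^2}A\Big[\frac{1}{1-\omega_L^2}\Big(\frac{Q}{2T_0}-\frac{\pi^2k\omega_L^2}{64\,l\,T_0}(A^2+B^2)\Big)+\Big(1-\frac{\omega_T^2}{4}\Big)\Big]+\frac{\alpha\omega}{2T_0}B=0,$$ $$\frac{\pi^2}{4l^2}B\Big[\frac{1}{1-\omega_L^2}\Big(\frac{Q}{2T_0}+\frac{\pi^2k\omega_L^2}{64\,l\,T_0}(A^2+B^2)\Big)-\Big(1-\frac{\omega_T^2}{4}\Big)\Big]+\frac{\alpha\omega}{2T_0}A=0.$$ Neglecting the nonlinear terms in these equations, one obtains the following approximate expression for the boundary of the main parametric resonance domain on the (excitation frequency, excitation amplitude) plane: $$Q=Q_L=\pm2T_0(1-\omega_L^2)\sqrt{\Big(\frac{2\alpha\omega l^2}{\pi^2T_0}\Big)^2+\Big(1-\frac{\omega_T^2}{4}\Big)^2}.$$ Here $\varkappa^2\ge1$, where $\varkappa=\dfrac{\pi^2Q}{4\alpha\omega l^2(1-\omega_L^2)}$.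
   Context: The underlying model is $M\ddot u+T_1=Q\cos\omega t$, $\rho\ddot w+\alpha\dot w+\frac{\pi^2}{4l^2}(T_0+T_1)w=0$, $T_1=k\big(u+\frac{\pi^2}{16l}w^2\big)$. It describes two equal masses $M$ with longitudinal displacements $\pm u(t)$, connected by an elastic string of length $2l$, mass per unit length $\rho$, stiffness $k/2$ and initial tensile force $T_0$; $w(t)$ is the transverse displacement of the string's midpoint, $\alpha$ is the viscosity number of the transverse oscillations, and $Q,\omega$ are the amplitude and frequency of the external longitudinal force. The balance equations come from inserting $w(t)=A\cos\frac{\omega t}{2}+B\sin\frac{\omega t}{2}$ (higher harmonics neglected), solving the first equation for the steady $u$, and requiring the second equation to hold on average in the main harmonics. The parametric resonance domain is the region of the frequency-amplitude plane where the longitudinal excitation produces transverse oscillations. *)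

(* Defs.v *)
From mathcomp Require Import all_boot all_order all_algebra.
From mathcomp Require Import all_classical all_reals all_analysis.

Set Implicit Arguments.
Unset Strict Implicit.
Unset Printing Implicit Defensive.

Import Order.TTheory GRing.Theory Num.Theory.
Import numFieldNormedType.Exports.

Local Open Scope ring_scope.
Local Open Scope classical_set_scope.

Definition Omega_L (R : realType) (M k : R) : R := Num.sqrt (k / M).

Definition Omega_T (R : realType) (rho l T0 : R) : R :=
  pi / (2 * l) * Num.sqrt (T0 / rho).

Definition omega_L (R : realType) (M k omega : R) : R := omega / Omega_L M k.

Definition omega_T (R : realType) (rho l T0 omega : R) : R :=
  omega / Omega_T rho l T0.

(* Left-hand sides of the balance equations in the harmonics cos (omega t / 2)
   and sin (omega t / 2), as functions of the pair of coefficients (A, B) of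
   w(t) = A cos (omega t / 2) + B sin (omega t / 2). *)
Definition balance_cos (R : realType) (M rho l k T0 alpha omega Q : R)
    (AB : R * R) : R :=
  let A := AB.1 in let B := AB.2 in
  let oL := omega_L M k omega in let oT := omega_T rho l T0 omega in
  pi ^+ 2 / (4 * l ^+ 2) * A *
    (1 / (1 - oL ^+ 2) *
       (Q / (2 * T0)
        - pi ^+ 2 * k * oL ^+ 2 / (64 * l * T0) * (A ^+ 2 + B ^+ 2))
     + (1 - oT ^+ 2 / 4))
  + alpha * omega / (2 * T0) * B.

Definition balance_sin (R : realType) (M rho l k T0 alpha omega Q : R)
    (AB : R * R) : R :=
  let A := AB.1 in let B := AB.2 in
  let oL := omega_L M k omega in let oT := omega_T rho l T0 omega in
  pi ^+ 2 / (4 * l ^+ 2) * B *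
    (1 / (1 - oL ^+ 2) *
       (Q / (2 * T0)
        + pi ^+ 2 * k * oL ^+ 2 / (64 * l * T0) * (A ^+ 2 + B ^+ 2))
     - (1 - oT ^+ 2 / 4))
  + alpha * omega / (2 * T0) * A.

(* The balance equations with their nonlinear terms in (A, B) neglected: both
   left-hand sides vanish at the rest state (A, B) = 0, so what is left of each
   of them is its differential there. *)
Definition linearized_balance (R : realType) (M rho l k T0 alpha omega Q : R)
    (AB : R * R) : Prop :=
  'd (balance_cos M rho l k T0 alpha omega Q) (0 : R * R) AB = 0 /\
  'd (balance_sin M rho l k T0 alpha omega Q) (0 : R * R) AB = 0.

(* First approximation to the boundary of the main resonance domain, as a set
   of points (omega, Q): the threshold at which a steady transverse oscillation
   of the linearized system with w not identically zero becomes possible. *)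
Definition resonance_boundary (R : realType) (M rho l k T0 alpha : R) :
    set (R * R) :=
  [set p | exists AB : R * R,
     AB <> 0 /\ linearized_balance M rho l k T0 alpha p.1 p.2 AB].

Definition Q_L (R : realType) (M rho l k T0 alpha omega : R) : R :=
  2 * T0 * (1 - omega_L M k omega ^+ 2) *
    Num.sqrt ((2 * alpha * omega * l ^+ 2 / (pi ^+ 2 * T0)) ^+ 2
              + (1 - omega_T rho l T0 omega ^+ 2 / 4) ^+ 2).

Definition varkappa (R : realType) (M l k alpha omega Q : R) : R :=
  pi ^+ 2 * Q / (4 * alpha * omega * l ^+ 2 * (1 - omega_L M k omega ^+ 2)).

(* Main.v *)
Require Import Defs.
From mathcomp Require Import all_boot all_order all_algebra.
From mathcomp Require Import all_classical all_reals all_analysis.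
From mathcomp Require Import ring.
Import Order.TTheory GRing.Theory Num.Theory.
Import numFieldNormedType.Exports.
Local Open Scope ring_scope.
Local Open Scope classical_set_scope.

(* With q = Q / (2 T0 (1 - omega_L^2)), m = 1 - omega_T^2 / 4 and
   r = 2 alpha omega l^2 / (pi^2 T0), the linearized equations are, up to the
   factor pi^2 / (4 l^2), the system (q + m) A + r B = 0, (q - m) B + r A = 0.
   It has a nonzero solution iff its determinant q^2 - m^2 - r^2 vanishes, which
   is Q = +- Q_L.  Moreover varkappa = q / r, and q^2 = m^2 + r^2 >= r^2. *)

(** Every monomial of the cubic part has degree three in [u] and [v], which vanish at 0, so only the
    linear part survives. Abstract forms [u] and [v] let one computation serve both balance
    equations, with the coordinates swapped. *)
Lemma diff_cubic_at0 {R : realType} {V : normedModType R}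
    (u v : {linear V -> R}) (a b d : R) (h : V) :
  continuous u -> continuous v ->
  'd (fun p => u p * (a + b * (u p ^+ 2 + v p ^+ 2)) + d * v p) 0 h
  = a * u h + d * v h.
Proof.
move=> cu cv.
(* A continuous linear form is its own differential; as [is_diff] facts, [du] and [dv] let
   [diff_val] differentiate the point-free expression below. *)
have du : is_diff (0 : V) u u.
  by apply: DiffDef; [exact: linear_differentiable | rewrite diff_lin].
have dv : is_diff (0 : V) v v.
  by apply: DiffDef; [exact: linear_differentiable | rewrite diff_lin].
have -> : (fun p => u p * (a + b * (u p ^+ 2 + v p ^+ 2)) + d * v p)
  = (u : V -> R) * (cst a + b *: ((u : V -> R) ^+ 2 + (v : V -> R) ^+ 2))
    + d *: (v : V -> R).
  by apply/funext => p.
rewrite diff_val !fctE /= !linear0 /GRing.scale /=.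
by ring.
Qed.

Lemma fst_continuous {R : realType} :
  continuous (fst : R * R -> R).
Proof. by move=> x; exact: cvg_fst. Qed.

Lemma snd_continuous {R : realType} :
  continuous (snd : R * R -> R).
Proof. by move=> x; exact: cvg_snd. Qed.

Lemma skew_system_has_nonzero_solution {F : fieldType} (q m r : F) : r != 0 ->
  (exists AB : F * F, AB <> 0 /\
     ((q + m) * AB.1 + r * AB.2 = 0 /\ (q - m) * AB.2 + r * AB.1 = 0))
  <-> q ^+ 2 = r ^+ 2 + m ^+ 2.
Proof.
move=> r0; split=> [[[A B] /= [nz [e1 e2]]]|e].
  (* Cramer's rule: eliminating [B] leaves the determinant times [A]. If [A] is 0, the first
     equation and [r != 0] force [B] to be 0 too. *)
  have dA : A * (q ^+ 2 - (r ^+ 2 + m ^+ 2)) = 0.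
    transitivity ((q - m) * ((q + m) * A + r * B) - r * ((q - m) * B + r * A)).
      by ring.
    by rewrite e1 e2; ring.
  move/eqP: dA; rewrite mulf_eq0 => /orP[/eqP A0|]; last first.
    by rewrite subr_eq0 => /eqP.
  move: e1; rewrite A0 mulr0 add0r => /eqP.
  rewrite mulf_eq0 (negbTE r0) /= => /eqP B0.
  by case: nz; rewrite A0 B0.
(* This vector annihilates the first row for any [q], and is nonzero since [r] is; the determinant
   condition settles the second row. *)
exists (r, - (q + m)); split=> /=.
  by case=> /eqP; rewrite (negbTE r0).
split; first by ring.
transitivity (r ^+ 2 + m ^+ 2 - q ^+ 2); first by ring.
by rewrite e subrr.
Qed.

Lemma linearized_balanceE {R : realType} (M rho l k T0 alpha omega Q : R)
    (AB : R * R) : 0 < l -> 0 < T0 -> 1 - omega_L M k omega ^+ 2 != 0 ->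
  let q := Q / (2 * T0 * (1 - omega_L M k omega ^+ 2)) in
  let m := 1 - omega_T rho l T0 omega ^+ 2 / 4 in
  let r := 2 * alpha * omega * l ^+ 2 / (pi ^+ 2 * T0) in
  linearized_balance M rho l k T0 alpha omega Q AB <->
  (q + m) * AB.1 + r * AB.2 = 0 /\ (q - m) * AB.2 + r * AB.1 = 0.
Proof.
move=> l0 T00; set s := 1 - _ => s0 q m r.
have pi0 : (pi : R) != 0 by rewrite gt_eqF// pi_gt0.
have ln0 : l != 0 by rewrite gt_eqF.
have Tn0 : T0 != 0 by rewrite gt_eqF.
pose c : R := pi ^+ 2 / (4 * l ^+ 2).
have c0 : c != 0.
  by rewrite /c mulf_neq0 ?invr_eq0 ?mulf_neq0 ?expf_neq0 ?pnatr_eq0.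
pose b := c * (s^-1 * (pi ^+ 2 * k * omega_L M k omega ^+ 2 / (64 * l * T0))).
(* Here [r] is the damping coefficient with the common factor [c] divided out. *)
have dc : alpha * omega / (2 * T0) = c * r.
  by rewrite /c /r; move: (pi : R) pi0 => p p0; field; rewrite Tn0 p0 ln0.
have cq : s^-1 * (Q / (2 * T0)) = q by rewrite /q; field; rewrite s0 Tn0.
have linE : linearized_balance M rho l k T0 alpha omega Q AB <->
    c * ((q + m) * AB.1 + r * AB.2) = 0 /\ c * ((q - m) * AB.2 + r * AB.1) = 0.
  rewrite /linearized_balance.
  (* The cubic coefficient is [- b] here and [b] in the sine equation; both drop out on
     differentiation. *)
  have -> : balance_cos M rho l k T0 alpha omega Q = (fun p : R * R =>
      p.1 * (c * (q + m) + (- b) * (p.1 ^+ 2 + p.2 ^+ 2)) + c * r * p.2).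
    apply/funext => p; rewrite /balance_cos -/s -/m -/c dc -cq /b div1r.
    by ring.
  have -> : balance_sin M rho l k T0 alpha omega Q = (fun p : R * R =>
      p.2 * (c * (q - m) + b * (p.2 ^+ 2 + p.1 ^+ 2)) + c * r * p.1).
    apply/funext => p; rewrite /balance_sin -/s -/m -/c dc -cq /b div1r.
    by ring.
  rewrite (diff_cubic_at0 fst snd _ _ _ _ fst_continuous
             snd_continuous).
  rewrite (diff_cubic_at0 snd fst _ _ _ _ snd_continuous
             fst_continuous).
  by rewrite -!(mulrA c) -!mulrDr.
have mulc_eq0 x : c * x = 0 <-> x = 0.
  by split=> [/eqP|->]; rewrite ?mulr0// mulf_eq0 (negbTE c0) => /eqP.
by rewrite linE !mulc_eq0.
Qed.

Theorem mainTheorem4 (R : realType) (M rho l k T0 alpha omega Q : R)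
    (HM : 0 < M) (Hrho : 0 < rho) (Hl : 0 < l) (Hk : 0 < k) (HT0 : 0 < T0)
    (Halpha : 0 < alpha) (Homega : 0 < omega)
    (Hnonres : omega_L M k omega <> 1) :
  (resonance_boundary M rho l k T0 alpha (omega, Q) <->
     Q = Q_L M rho l k T0 alpha omega \/ Q = - Q_L M rho l k T0 alpha omega)
  /\ (resonance_boundary M rho l k T0 alpha (omega, Q) ->
        1 <= varkappa M l k alpha omega Q ^+ 2).
Proof.
have pi0 : 0 < (pi : R) := pi_gt0 R.
have oL0 : 0 < omega_L M k omega.
  by rewrite /omega_L /Omega_L divr_gt0 // sqrtr_gt0 divr_gt0.
(* The root 1 is excluded by [Hnonres], the root -1 by positivity of [omega_L]. *)
have s0 : 1 - omega_L M k omega ^+ 2 != 0.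
  rewrite subr_eq0 eq_sym sqrf_eq1 negb_or; apply/andP; split; first exact/eqP.
  by rewrite gt_eqF // (lt_trans _ oL0) // oppr_lt0.
rewrite /Q_L /varkappa.
have lin := fun AB =>
  @linearized_balanceE R M rho l k T0 alpha omega Q AB Hl HT0 s0.
set s := 1 - omega_L M k omega ^+ 2 in s0 lin *.
set m := 1 - _ / 4 in lin *.
set r := _ / (pi ^+ 2 * T0) in lin *.
pose q := Q / (2 * T0 * s).
have r0 : 0 < r by rewrite /r !(divr_gt0, mulr_gt0, exprn_gt0).
have boundaryE : resonance_boundary M rho l k T0 alpha (omega, Q) <->
    q ^+ 2 = r ^+ 2 + m ^+ 2.
  rewrite -skew_system_has_nonzero_solution ?gt_eqF //.
  by split=> -[AB [nz /lin H]]; exists AB.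
have t0 : 2 * T0 * s != 0 by rewrite mulf_neq0 // mulf_neq0 ?pnatr_eq0 ?(gt_eqF HT0).
have Qq : Q = 2 * T0 * s * q by rewrite /q mulrC divfK.
split.
  rewrite boundaryE.
  (* Equal squares give [q] up to sign; multiplying by the nonzero [2 * T0 * s], of either sign,
     turns this into [Q] being plus or minus [Q_L]. *)
  have -> : (q ^+ 2 = r ^+ 2 + m ^+ 2) <->
      q ^+ 2 = Num.sqrt (r ^+ 2 + m ^+ 2) ^+ 2.
    by rewrite sqr_sqrtr // addr_ge0 // sqr_ge0.
  rewrite {1 2}Qq -mulrN; split.
    by move/eqP; rewrite eqf_sqr => /orP[] /eqP <-; [left|right].
  by case=> /(mulfI t0) ->; rewrite ?sqrrN.
move=> /boundaryE e.
have -> : pi ^+ 2 * Q / (4 * alpha * omega * l ^+ 2 * s) = q / r.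
  rewrite /q /r; move: (pi : R) pi0 => p p0.
  by field; rewrite s0 !gt_eqF.
by rewrite expr_div_n ler_pdivlMr ?exprn_gt0 // mul1r e lerDl sqr_ge0.
Qed.
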